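(* $H_{\mathrm{even}}\cap(40000,45000]$ is contained in the thirty-three-element candidate set \[ \begin{aligned} \{ & 40234, 40466, 40538, 40574, 40822, 40886, 41126, 41326, 41386,\\ & 41714, 41758, 41878, 41898, 42134, 42314, 42358, 42646, 42766,\\ & 43058, 43154, 43322, 43402, 43574, 43634, 43642, 43678, 43786,\\ & 44054, 44186, 44294, 44378, 44518, 44582 \}. \end{aligned} \]
   Context: 3-Higgs primes are defined recursively: $2$ is 3-Higgs; an odd prime $p$ is 3-Higgs if and only if every prime factor $q$ of $p-1$ is a 3-Higgs prime (necessarily $q<p$) and satisfies $v_q(p-1)\le 3$ (including $v_2(p-1)\le 3$), where $v_q$ is the $q$-adic valuation. $H$ is the set of integers $m\ge 1$ such that every prime factor of $2^m+1$ is 3-Higgs, and $H_{\mathrm{even}}=H\cap 2\mathbb{Z}$. *)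

(* Defs.v *)
From mathcomp Require Import all_boot.

Set Implicit Arguments.
Unset Strict Implicit.
Unset Printing Implicit Defensive.

(* Every premise on higgs3 concerns primes q < p, so the least fixed point taken
   here is the only predicate satisfying the recursive description; see
   higgs3_odd_iff. *)
Inductive higgs3 : nat -> Prop :=
| Higgs3Two : higgs3 2
| Higgs3Odd (p : nat) of prime p & odd p
    & (forall q, prime q -> q %| p.-1 -> higgs3 q)
    & (forall q, prime q -> q %| p.-1 -> logn q p.-1 <= 3) : higgs3 p.

Lemma higgs3_odd_iff (p : nat) : prime p -> odd p ->
  higgs3 p <->
  (forall q, prime q -> q %| p.-1 -> higgs3 q /\ logn q p.-1 <= 3).
Proof.
move=> p_pr p_odd; split=> [hp|hq].
  by case: hp p_odd => // r _ _ hr vr _ q q_pr q_dvd; split; [apply: hr|apply: vr].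
by apply: Higgs3Odd => // q q_pr q_dvd; case: (hq q q_pr q_dvd).
Qed.

Lemma higgs3_prime (p : nat) : higgs3 p -> prime p.
Proof. by case. Qed.

Definition H (m : nat) : Prop :=
  1 <= m /\ forall p, prime p -> p %| 2 ^ m + 1 -> higgs3 p.

Definition H_even (m : nat) : Prop := H m /\ ~~ odd m.

(* Main.v *)
From Stdlib Require Import PArith BinNat Nnat.
From mathcomp Require Import all_boot cyclic zify.
Require Import Defs.

Set Implicit Arguments.
Unset Strict Implicit.
Unset Printing Implicit Defensive.

(** Why the theorem is true.  If [4 %| m], then [2 ^ m + 1] has a Fermat number
    [2 ^ 2 ^ j + 1] with [j >= 2] as a factor, whose prime factors are 1 modulo
    16 and hence not 3-Higgs ([H_even_double_odd]).  So [m = 2 * n] with [n] odd,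
    and then [2 ^ (2 * d) + 1] divides [2 ^ m + 1] for every divisor [d] of [n]
    ([H_factor]): one prime factor of [2 ^ (2 * d) + 1] that is not 3-Higgs
    excludes every [n] that is a multiple of [d].

    There are two kinds of such obstructions.  If a prime [l] that is not 3-Higgs
    divides [n], no computation is needed: [2 ^ (2 * l) + 1] has a prime factor
    [r] with [4 * l %| r - 1] ([primitive_factor_exists]), so [r] cannot be
    3-Higgs either ([H_exponent_factor]).  Otherwise an explicit prime factor [P]
    of some [2 ^ (2 * d) + 1] is exhibited.  That a prime is not 3-Higgs is
    witnessed by a descending chain of primes, each dividing its predecessor
    minus 1, down to one whose fourth power does ([nonhiggs_certP]).

    The primality of [P] is cheap because its prime factors are rare a priori:
    if [l] is a prime factor of [d], the order of 2 modulo any prime factor [r]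
    of [P] is a multiple of [4 * l], unless [r] divides [2 ^ (2 * (d / l)) + 1],
    so [r] is 1 modulo [4 * l] ([pred_prime_factor_4l]) and trial division runs
    over one residue class only.  For the largest [P] the modulus of that class
    is enlarged by Pocklington's criterion ([pocklingtonP]).

    What remains is to verify the obstructions in binary arithmetic
    ([obstructions_valid]) and to see that they reach every odd [n] in the range
    whose double is not listed ([all_settled]). *)

(** * Orders modulo a prime *)

Lemma expn_gcdn_eq1 (r x a b : nat) : 0 < a ->
  x ^ a = 1 %[mod r] -> x ^ b = 1 %[mod r] -> x ^ gcdn a b = 1 %[mod r].
Proof.
move=> a_gt0 xa xb; have [u _ /dvdnP[v Eg]] := Bezoutl b a_gt0.
have xM c k : x ^ c = 1 %[mod r] -> x ^ (k * c) = 1 %[mod r].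
  by move=> xc; rewrite mulnC expnM -modnXm xc modnXm exp1n.
have := xM a v xa; rewrite -Eg expnD -modnMmr (xM b u xb) modnMmr muln1.
by [].
Qed.

(** Fermat's little theorem allows the exponent [s ^ k * e] to be replaced by its
    gcd with [r - 1], which misses a factor [s] as soon as [s ^ k] does not
    divide [r - 1].  All congruences for prime factors below come from this, read
    backwards: if [x ^ (s ^ k.-1 * e)] is not 1, then [s ^ k] divides [r - 1]. *)
Lemma expn_eq1_drop_prime (r s k x e : nat) : prime r -> prime s -> 0 < k -> 0 < e ->
  x ^ (s ^ k * e) = 1 %[mod r] -> ~~ (s ^ k %| r.-1) ->
  x ^ (s ^ k.-1 * e) = 1 %[mod r].
Proof.
move=> r_pr s_pr k_gt0 e_gt0 xq sNr.
have ske_gt0 : 0 < s ^ k * e by rewrite muln_gt0 expn_gt0 prime_gt0.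
have r1_gt0 : 0 < r.-1 by rewrite -ltnS prednK ?prime_gt0 // prime_gt1.
have rNx : ~~ (r %| x).
  apply/negP => rx.
  have : r %| x ^ (s ^ k * e) by rewrite dvdn_exp.
  by move/eqP; rewrite xq modn_small ?prime_gt1.
have xr : x ^ r.-1 = 1 %[mod r].
  by rewrite -totient_prime // Euler_exp_totient // coprime_sym prime_coprime.
have xg := expn_gcdn_eq1 r1_gt0 xr xq.
suff /dvdnP[c ->] : gcdn r.-1 (s ^ k * e) %| s ^ k.-1 * e.
  by rewrite mulnC expnM -modnXm xg modnXm exp1n.
have g_gt0 : 0 < gcdn r.-1 (s ^ k * e) by rewrite gcdn_gt0 r1_gt0.
apply/dvdn_partP => // p; rewrite mem_primes => /andP[p_pr /andP[_ _]].
rewrite p_part pfactor_dvdn ?muln_gt0 ?expn_gt0 ?(prime_gt0 s_pr) ?e_gt0 //.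
rewrite logn_gcd // !lognM ?expn_gt0 ?(prime_gt0 s_pr) // !lognX (logn_prime p s_pr).
have [->|pNs] := eqVneq p s.
  rewrite /= !muln1; apply: (leq_trans (geq_minl _ _)).
  apply: (leq_trans _ (leq_addr _ _)); rewrite -ltnS prednK // ltnNge.
  by apply: contra sNr => ?; rewrite pfactor_dvdn.
by rewrite /= !muln0 geq_minr.
Qed.

(** Since [2 ^ (2 * (l * e))] is -1 modulo [r], no exponent dividing
    [2 * (l * e)] gives 1.  Removing a factor 2 from [4 * (l * e)] would give such
    an exponent; removing [l] gives [2 ^ (4 * e) = 1], hence [2 ^ (2 * e)] is 1 or
    -1, and -1 is excluded by hypothesis. *)
Lemma pred_prime_factor_4l (r l e : nat) : prime r -> prime l -> odd l -> 0 < e ->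
  r %| 2 ^ (2 * (l * e)) + 1 -> ~~ (r %| 2 ^ (2 * e) + 1) -> 4 * l %| r.-1.
Proof.
move=> r_pr l_pr l_odd e_gt0 rD rND.
have r_gt1 := prime_gt1 r_pr.
have le_gt0 : 0 < l * e by rewrite muln_gt0 prime_gt0.
have rN2 : r != 2.
  apply: contraTneq rD => ->; rewrite dvdn2 oddD oddX /=.
  by rewrite muln_eq0 /= -leqn0 leqNgt le_gt0.
have not1 : 2 ^ (2 * (l * e)) <> 1 %[mod r].
  move=> E1; have : r %| 2.
    by rewrite -[2]/(1 + 1) /dvdn -modnDml -E1 modnDml; exact: rD.
  by rewrite dvdn_prime2 // (negbTE rN2).
have sqr1 a : r %| 2 ^ (2 * a) + 1 -> 2 ^ (4 * a) = 1 %[mod r].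
  move=> rDa; apply/eqP; rewrite eqn_mod_dvd ?expn_gt0 //.
  rewrite -[4]/(2 * 2) -mulnA mulnC expnM -[1](exp1n 2) subn_sqr.
  by rewrite dvdn_mull.
have E4 := sqr1 _ rD.
rewrite Gauss_dvd; last by rewrite (@coprimeXl 2 2) // coprime2n.
apply/andP; split.
  apply/negPn/negP => N4; apply: not1.
  by have := @expn_eq1_drop_prime r 2 2 2 (l * e) r_pr isT isT le_gt0 E4 N4.
apply/negPn/negP => Nl; apply: not1.
have Nl1 : ~~ (l ^ 1 %| r.-1) by rewrite expn1.
have := @expn_eq1_drop_prime r l 1 2 (4 * e) r_pr l_pr isT.
rewrite muln_gt0 e_gt0 /= expn1 mulnCA => /(_ isT E4 Nl1).
rewrite expn0 mul1n => E4e.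
have : r %| (2 ^ (2 * e) - 1) * (2 ^ (2 * e) + 1).
  rewrite -[1 in X in _ %| X](exp1n 2) -subn_sqr -expnM mulnAC exp1n.
  by rewrite -eqn_mod_dvd ?expn_gt0 //; apply/eqP.
rewrite Euclid_dvdM // (negbTE rND) orbF -eqn_mod_dvd ?expn_gt0 // => /eqP E2e.
by rewrite mulnCA mulnC expnM -modnXm E2e modnXm exp1n.
Qed.

(** Only the prime factor 5 of [2 ^ (2 * l) + 1] can fail to be 1 modulo [4 * l].
    It always occurs, but 25 does not divide [4 ^ l + 1] unless [5 %| l], so the
    cofactor of 5 has no factor 5 left. *)
Lemma primitive_factor_exists (l : nat) : prime l -> odd l -> l != 5 ->
  exists r, [/\ prime r, r %| 2 ^ (2 * l) + 1 & 4 * l %| r.-1].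
Proof.
move=> l_pr l_odd lN5.
have E4 : 2 ^ (2 * l) = 4 ^ l by rewrite expnM.
have D5 : 5 %| 2 ^ (2 * l) + 1.
  rewrite E4 /dvdn -modnDml -modnXm -(odd_double_half l) l_odd -mul2n expnD.
  by rewrite expnM -modnMmr -modnXm exp1n.
have [q Eq] := dvdnP D5.
have q_gt1 : 1 < q.
  rewrite -(ltn_pmul2r (isT : 0 < 5)) mul1n -Eq addn1 ltnS E4.
  by rewrite (@leq_trans (4 ^ 2)) // leq_exp2l // prime_gt1.
have r_pr := pdiv_prime q_gt1.
have rD : pdiv q %| 2 ^ (2 * l) + 1 by rewrite Eq dvdn_mulr ?pdiv_dvd.
exists (pdiv q); split=> //.
have := @pred_prime_factor_4l (pdiv q) l 1 r_pr l_pr l_odd isT.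
rewrite !muln1; apply=> //.
(* 4 has order 10 modulo 25, so 4^l = -1 only depends on l modulo 10 *)
rewrite -[2 ^ 2 + 1]/5 dvdn_prime2 //; apply: contraNneq lN5 => Er.
have D25 : 25 %| 4 ^ l + 1.
  by rewrite -E4 Eq -[25]/(5 * 5) dvdn_pmul2r // -Er pdiv_dvd.
rewrite eq_sym -dvdn_prime2 //.
have E10 : 4 ^ l = 4 ^ (l %% 10) %[mod 25].
  have E1 : (4 ^ 10) ^ (l %/ 10) = 1 %[mod 25].
    by rewrite -modnXm (expnM 4 5 2) -modnXm modnXm exp1n.
  by rewrite {1}(divn_eq l 10) expnD (mulnC _ 10) expnM -modnMml E1 modnMml mul1n.
move: D25; rewrite /dvdn -modnDml E10 modnDml -(@modn_dvdm 10 l 5) //.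
by have := ltn_pmod l (isT : 0 < 10); case: (l %% 10) => [|[|[|[|[|[|[|[|[|[|]]]]]]]]]].
Qed.

(** * Prime factors of 2^(2n) + 1 for n in H *)

Lemma higgs3_pred_factor (p q : nat) : higgs3 p -> prime q -> q %| p.-1 -> higgs3 q.
Proof.
case=> [|{}p _ _ hr _]; last exact: hr.
by move=> q_pr; rewrite dvdn1 => /eqP q1; rewrite q1 in q_pr.
Qed.

Lemma higgs3_pred_pow4 (p q : nat) : higgs3 p -> prime q -> ~~ (q ^ 4 %| p.-1).
Proof.
case=> [|{}p p_pr _ _ vr] q_pr.
  by rewrite dvdn1 neq_ltn orbC -[1](expn0 q) ltn_exp2l ?prime_gt1.
have p1_gt0 : 0 < p.-1 by rewrite -ltnS prednK ?prime_gt0 // prime_gt1.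
apply/negP => q4; have := vr q q_pr (dvdn_trans (dvdn_exp (isT : 0 < 4) (dvdnn q)) q4).
by rewrite leqNgt => /negP; apply; rewrite -pfactor_dvdn.
Qed.

Lemma dvdn_expD1 (x d n : nat) : odd n -> d %| n -> x ^ d + 1 %| x ^ n + 1.
Proof.
move=> n_odd /dvdnP[k En]; have := n_odd; rewrite {}En mulnC expnM oddM.
move=> /andP[_ k_odd]; move: (x ^ d) => y.
have [->|y_gt0] := posnP y; first exact: dvd1n.
rewrite -(odd_double_half k) k_odd add1n; elim: k./2 => [|j IHj]; first by rewrite expn1.
have -> : y ^ (j.+1).*2.+1 + 1 = y ^ 2 * (y ^ j.*2.+1 + 1) - (y ^ 2 - 1 ^ 2).
  rewrite mulnDr -expnD muln1 doubleS add2n.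
  have : 0 < y ^ 2 by rewrite expn_gt0 y_gt0.
  move: (y ^ 2) (y ^ _) => a b; rewrite exp1n; lia.
by rewrite dvdn_sub // ?dvdn_mull // subn_sqr dvdn_mull.
Qed.

Lemma H_factor (n d p : nat) : odd n -> H (2 * n) -> d %| n -> prime p ->
  p %| 2 ^ (2 * d) + 1 -> higgs3 p.
Proof.
move=> n_odd [_ hH] dn p_pr pd; apply: hH => //; apply: dvdn_trans pd _.
by rewrite !expnM dvdn_expD1.
Qed.

Lemma higgs3_5 : higgs3 5.
Proof.
apply/higgs3_odd_iff => // q q_pr; rewrite -[_.-1]/(2 ^ 2) Euclid_dvdX //=.
by rewrite andbT dvdn_prime2 // => /eqP->; split; [exact: Higgs3Two | rewrite lognX].
Qed.

(** The prime 5 is not reached by [primitive_factor_exists], whose counting of the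
    factors 5 breaks down for [2 ^ 10 + 1 = 5 ^ 2 * 41]; but 5 is 3-Higgs. *)
Lemma H_exponent_factor (n l : nat) : odd n -> H (2 * n) -> prime l -> l %| n ->
  higgs3 l.
Proof.
move=> n_odd hH l_pr ln; have l_odd := dvdn_odd ln n_odd.
have [->|lN5] := eqVneq l 5; first exact: higgs3_5.
have [r [r_pr rD lr]] := primitive_factor_exists l_pr l_odd lN5.
apply: (higgs3_pred_factor (H_factor n_odd hH ln r_pr rD)) l_pr _.
by apply: dvdn_trans lr; rewrite dvdn_mull.
Qed.

(** A prime factor [r] of the Fermat number [2 ^ 2 ^ j + 1] satisfies
    [2 ^ j.+1 %| r - 1], so [16 %| r - 1] when [j >= 3].  For [j = 2] the number
    itself is the prime 17, and 16 divides 17 - 1. *)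
Lemma H_even_double_odd (m : nat) : H_even m -> exists2 n, odd n & m = 2 * n.
Proof.
case=> -[m_gt0 hH] m_even; exists (m %/ 2); last by rewrite mulnC divnK ?dvdn2.
apply/negPn/negP => m2_even.
have m4 : 4 %| m.
  by rewrite -(divnK (_ : 2 %| m)) ?dvdn2 // -[4]/(2 * 2) dvdn_pmul2r ?dvdn2.
have [k kNodd Em] : exists2 t, odd t & m = t * 2 ^ logn 2 m.
  by have [t ?] := pfactor_coprime (isT : prime 2) m_gt0; exists t; rewrite // -coprime2n.
have k_ge2 : 1 < logn 2 m by rewrite -pfactor_dvdn.
move: (logn 2 m) k_ge2 Em => j j_ge2 Em.
have hF r : prime r -> r %| 2 ^ (2 ^ j) + 1 -> higgs3 r.
  move=> r_pr rD; apply: hH => //; apply: dvdn_trans rD _.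
  by rewrite Em mulnC expnM -{1}[2 ^ 2 ^ j]expn1 dvdn_expD1.
have [j_eq2|j_neq2] := eqVneq j 2.
  have h17 : higgs3 17 by apply: hF => //; rewrite j_eq2.
  by have := higgs3_pred_pow4 h17 (isT : prime 2).
have F_gt1 : 1 < 2 ^ (2 ^ j) + 1 by rewrite addn1 ltnS expn_gt0.
have r_pr := pdiv_prime F_gt1; have rD := pdiv_dvd (2 ^ (2 ^ j) + 1).
have r_higgs := hF _ r_pr rD; set r := pdiv _ in r_pr rD r_higgs.
have := higgs3_pred_pow4 r_higgs (isT : prime 2).
apply/negP/negPn; suff rF : 2 ^ j.+1 %| r.-1.
  by apply: dvdn_trans rF; rewrite dvdn_exp2l // ltn_neqAle eq_sym j_neq2.
apply/negPn/negP => Nr.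
have rN2 : ~~ (r %| 2).
  rewrite dvdn_prime2 //; apply: contraTneq rD => ->.
  by rewrite dvdn2 oddD oddX /= expn_eq0.
have E1 : 2 ^ (2 ^ j.+1 * 1) = 1 %[mod r].
  apply/eqP; rewrite muln1 expnSr expnM eqn_mod_dvd ?expn_gt0 //.
  by rewrite -[1](exp1n 2) subn_sqr dvdn_mull.
have := expn_eq1_drop_prime r_pr (isT : prime 2) (ltn0Sn j) (isT : 0 < 1) E1 Nr.
rewrite muln1 /= => E2; case/negP: rN2.
by rewrite -[2]/(1 + 1) /dvdn -modnDml -E2 modnDml; exact: rD.
Qed.

(** * Modular arithmetic on binary numbers *)

Definition dvdb (a b : N) : bool := N.eqb (N.modulo b a) 0.

Fixpoint powmod_pos (x P : N) (e : positive) : N :=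
  match e with
  | xH => N.modulo x P
  | xO e' => let y := powmod_pos x P e' in N.modulo (N.mul y y) P
  | xI e' => let y := powmod_pos x P e' in N.modulo (N.mul (N.mul y y) x) P
  end.

Definition powmod (x e P : N) : N :=
  if e is Npos e' then powmod_pos x P e' else N.modulo 1 P.

Lemma to_natM a b : N.to_nat (N.mul a b) = N.to_nat a * N.to_nat b.
Proof. exact: N2Nat.inj_mul. Qed.

Lemma to_natD a b : N.to_nat (N.add a b) = N.to_nat a + N.to_nat b.
Proof. exact: N2Nat.inj_add. Qed.

Lemma to_natB a b : N.to_nat (N.sub a b) = N.to_nat a - N.to_nat b.
Proof. exact: N2Nat.inj_sub. Qed.

Lemma to_nat_mod a b : N.to_nat (N.modulo a b) = N.to_nat a %% N.to_nat b.
Proof.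
case: b => [|b]; first by rewrite N.mod_0_r modn0.
have bN0 : Npos b <> N0 by [].
rewrite {2}(N.div_mod a _ bN0) to_natD to_natM mulnC modnMDl modn_small //.
have := N.mod_lt a _ bN0; move: (N.modulo _ _) => c; lia.
Qed.

Lemma dvdbE a b : dvdb a b = (N.to_nat a %| N.to_nat b).
Proof.
rewrite /dvdb /dvdn -to_nat_mod; move: (N.modulo b a) => c.
by apply/N.eqb_spec/eqP; lia.
Qed.

Lemma to_nat_powmod x e P :
  N.to_nat (powmod x e P) = N.to_nat x ^ N.to_nat e %% N.to_nat P.
Proof.
case: e => [|e] /=; first exact: to_nat_mod.
elim: e => [e IHe|e IHe|] /=; rewrite to_nat_mod ?to_natM ?IHe.
- have -> : Pos.to_nat (xI e) = (Pos.to_nat e + Pos.to_nat e).+1 by lia.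
  by rewrite -modnMml modnMm modnMml expnSr expnD.
- have -> : Pos.to_nat (xO e) = Pos.to_nat e + Pos.to_nat e by lia.
  by rewrite modnMm expnD.
- by rewrite expn1.
Qed.

Lemma dvdn_to_nat_gcd r a b :
  r %| N.to_nat a -> r %| N.to_nat b -> r %| N.to_nat (N.gcd a b).
Proof.
have toN c : r %| N.to_nat c -> N.divide (N.of_nat r) c.
  by case/dvdnP=> k Ek; exists (N.of_nat k); apply: N2Nat.inj; rewrite to_natM !Nat2N.id.
move=> ra rb; have [k ->] := N.gcd_greatest _ _ _ (toN a ra) (toN b rb).
by rewrite to_natM Nat2N.id dvdn_mull.
Qed.

(** * Primality certificates *)

(** Trial division of [P] by [t], [t + F], [t + 2 * F] and so on, until the square
    of the divisor exceeds [P]; running out of [fuel] counts as failure.  The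
    nested conditionals, unlike [||] and [&&], stop the recursion early under
    call-by-value evaluation. *)
Fixpoint no_divisor_from (fuel : nat) (P F t : N) : bool :=
  if fuel is fuel'.+1 then
    if N.ltb P (N.mul t t) then true
    else if dvdb t P then false else no_divisor_from fuel' P F (N.add t F)
  else false.

Lemma no_divisor_fromP fuel P F t j : no_divisor_from fuel P F t ->
  let r := N.to_nat t + j * N.to_nat F in r ^ 2 <= N.to_nat P -> ~~ (r %| N.to_nat P).
Proof.
elim: fuel t j => // fuel IHf t j /=; case: N.ltb_spec0 => [Pt _|_].
  have : N.to_nat P < N.to_nat t ^ 2.
    by rewrite -mulnn -to_natM; lia.
  move=> Pt2 le_r2.
  have tr : N.to_nat t ^ 2 <= (N.to_nat t + j * N.to_nat F) ^ 2.
    by rewrite leq_sqr leq_addr.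
  by have := leq_trans Pt2 (leq_trans tr le_r2); rewrite ltnn.
case: ifP => // /negbT tP tail; case: j => [|j]; first by rewrite addn0 -dvdbE.
by have := IHf _ j tail; rewrite to_natD mulSn addnA.
Qed.

Arguments no_divisor_from : simpl never.

Lemma prime_no_divisor fuel P F : 1 < N.to_nat P -> 0 < N.to_nat F ->
  (forall r, prime r -> r %| N.to_nat P -> N.to_nat F %| r.-1) ->
  no_divisor_from fuel P F (N.add F 1) -> prime (N.to_nat P).
Proof.
move=> P_gt1 F_gt0 rF noD; apply/negPn/negP => /primePns[|[r [r_pr r2 rP]]].
  by rewrite ltnNge P_gt1.
have [k Ek] := dvdnP (rF r r_pr rP).
have k_gt0 : 0 < k by case: k Ek (prime_gt1 r_pr) => //; case: r {r_pr r2 rP} => [|[]].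
have Er : r = N.to_nat (N.add F 1) + k.-1 * N.to_nat F.
  rewrite to_natD addnAC -mulSn prednK // -Ek -[N.to_nat 1]/1 addn1 prednK //.
  exact: prime_gt0.
by have := no_divisor_fromP (j := k.-1) noD; rewrite -Er => /(_ r2)/negP.
Qed.

(** The base is not 2, because the order of 2 modulo [P] divides [4 * d] for
    the factors [P] of [2 ^ (2 * d) + 1], so it carries no information on the
    other prime factors of [P - 1]. *)
Definition pocklington (P s : N) : bool :=
  [&& dvdb s (N.sub P 1), N.eqb (powmod 3 (N.sub P 1) P) 1 &
   N.eqb (N.gcd (N.sub (powmod 3 (N.div (N.sub P 1) s) P) 1) P) 1].

Lemma pocklingtonP P s r : 1 < N.to_nat P -> prime (N.to_nat s) -> pocklington P s ->
  prime r -> r %| N.to_nat P -> N.to_nat s %| r.-1.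
Proof.
move=> P_gt1 s_pr /and3P[sP /N.eqb_spec Epow /N.eqb_spec Egcd] r_pr rP.
apply/negPn/negP => Ns.
have sN0 : s <> N0 by move=> s0; rewrite s0 in s_pr.
set e := N.div (N.sub P 1) s in Egcd.
have EP : N.to_nat P - 1 = N.to_nat s * N.to_nat e.
  rewrite -[1]/(N.to_nat 1) -to_natB -to_natM; congr N.to_nat.
  by rewrite {1}(N.div_mod (N.sub P 1) s sN0); move/N.eqb_spec: sP => ->; rewrite N.add_0_r.
have e_gt0 : 0 < N.to_nat e.
  by case: (N.to_nat e) EP => // /eqP; rewrite muln0 subn_eq0 leqNgt P_gt1.
have Er1 : 3 ^ (N.to_nat s ^ 1 * N.to_nat e) = 1 %[mod r].
  rewrite expn1 -EP -(modn_dvdm _ rP) -[X in _ - X]/(N.to_nat 1) -to_natB.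
  by rewrite -[3]/(N.to_nat 3) -to_nat_powmod Epow.
have Ns1 : ~~ (N.to_nat s ^ 1 %| r.-1) by rewrite expn1.
have := expn_eq1_drop_prime r_pr s_pr (isT : 0 < 1) e_gt0 Er1 Ns1; rewrite mul1n => Ee.
have : r %| N.to_nat (N.gcd (N.sub (powmod 3 e P) 1) P).
  apply: dvdn_to_nat_gcd => //; rewrite to_natB to_nat_powmod -[N.to_nat 1]/1.
  have [->|y_gt0] := posnP (N.to_nat 3 ^ N.to_nat e %% N.to_nat P); first by rewrite dvdn0.
  by rewrite -eqn_mod_dvd // modn_dvdm //; apply/eqP.
rewrite Egcd dvdn1 => /eqP r1; by rewrite r1 in r_pr.
Qed.

Definition trial_fuel : nat := 4000.

(** Certifies [P], all of whose prime factors are known to be 1 modulo [F].  In a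
    list [s :: ss'], the prime [s] divides [P - 1] and enlarges the modulus to
    [F * s], while [ss'] certifies [s] itself starting from the modulus 2. *)
Fixpoint prime_cert (F P : N) (ss : seq N) : bool :=
  match ss with
  | [::] => no_divisor_from trial_fuel P F (N.add F 1)
  | s :: ss' =>
    [&& N.ltb 2 s, N.odd s, prime_cert 2 s ss', pocklington P s, N.eqb (N.gcd F s) 1
      & no_divisor_from trial_fuel P (N.mul F s) (N.add (N.mul F s) 1)]
  end.

Lemma odd_to_nat n : odd (N.to_nat n) = N.odd n.
Proof.
case: n => [|[p|p|]] //.
  have -> : N.to_nat (Npos (xI p)) = (2 * Pos.to_nat p).+1 by lia.
  by rewrite /= oddM.
have -> : N.to_nat (Npos (xO p)) = 2 * Pos.to_nat p by lia.
by rewrite oddM.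
Qed.

Lemma prime_pred_even P r : N.odd P -> prime r -> r %| N.to_nat P -> N.to_nat 2 %| r.-1.
Proof.
rewrite -odd_to_nat => P_odd r_pr rP; have r_odd := dvdn_odd rP P_odd.
by rewrite dvdn2 -subn1 oddB ?prime_gt0 // r_odd.
Qed.

Lemma prime_certP ss F P : 1 < N.to_nat P -> 0 < N.to_nat F ->
  (forall r, prime r -> r %| N.to_nat P -> N.to_nat F %| r.-1) ->
  prime_cert F P ss -> prime (N.to_nat P).
Proof.
elim: ss F P => [|s ss IHs] F P P_gt1 F_gt0 rF.
  exact: (@prime_no_divisor trial_fuel).
rewrite [prime_cert _ _ _]/=.
case/and5P=> /N.ltb_spec0 s_gt2 s_odd s_cert pock /andP[/N.eqb_spec Fs noD].
have s_gt1 : 1 < N.to_nat s by lia.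
have s_pr : prime (N.to_nat s).
  by apply: (IHs 2%num s) => // r; apply: prime_pred_even.
apply: (@prime_no_divisor trial_fuel _ _ _ _ _ noD) => //; rewrite to_natM.
  by rewrite muln_gt0 F_gt0 ltnW.
move=> r r_pr rP; rewrite Gauss_dvd ?rF ?(pocklingtonP P_gt1 s_pr pock) //.
by rewrite /coprime -dvdn1 -[1]/(N.to_nat 1) -Fs dvdn_to_nat_gcd ?dvdn_gcdl ?dvdn_gcdr.
Qed.

Definition certified_prime (q : N) (ss : seq N) : bool :=
  N.eqb q 2 || [&& N.ltb 2 q, N.odd q & prime_cert 2 q ss].

Lemma certified_primeP q ss : certified_prime q ss -> prime (N.to_nat q).
Proof.
case/orP=> [/N.eqb_spec -> //|/and3P[/N.ltb_spec0 q_gt2 q_odd]].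
by apply: prime_certP => [|//|r]; [lia | apply: prime_pred_even].
Qed.

(** * Obstructions *)

(** The chain [r1, r2, ..., rk] of primes (each with its primality certificate)
    satisfies [r1 %| q - 1], [r2 %| r1 - 1] and so on.  It ends as soon as a
    fourth power appears: [rk ^ 4] breaks the bound 3 on the valuation, and
    failing to be 3-Higgs climbs back up to [q]. *)
Fixpoint nonhiggs_cert (q : N) (c : seq (N * seq N)) : bool :=
  if c is (r, ss) :: c' then
    certified_prime r ss &&
    (dvdb (N.square (N.square r)) (N.sub q 1) || dvdb r (N.sub q 1) && nonhiggs_cert r c')
  else false.

Lemma nonhiggs_certP q c : nonhiggs_cert q c -> ~ higgs3 (N.to_nat q).
Proof.
elim: c q => // -[r ss] c IHc q /= /andP[/certified_primeP r_pr].
rewrite !dvdbE to_natB subn1.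
rewrite !N.square_spec !to_natM !mulnn -expnM.
case/orP=> [r4 hq|/andP[rq /IHc rbad] hq].
  by move/negP: (higgs3_pred_pow4 hq r_pr).
exact: rbad (higgs3_pred_factor hq r_pr rq).
Qed.

(** [BadExponent l c]: the prime [l], not 3-Higgs by the chain [c], divides [n].
    [BadFactor d l P ss c]: [d] divides [n], and [P] is a prime factor of
    [2 ^ (2 * d) + 1] that is not 3-Higgs by the chain [c].  The prime factor [l]
    of [d] and the list [ss] serve to certify that [P] is prime. *)
Inductive obstruction : Type :=
| BadExponent (l : N) (c : seq (N * seq N))
| BadFactor (d l P : N) (ss : seq N) (c : seq (N * seq N)).

Definition exponent (o : obstruction) : N :=
  match o with BadExponent l _ => l | BadFactor d _ _ _ _ => d end.

Definition valid (o : obstruction) : bool :=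
  match o with
  | BadExponent l c => certified_prime l [::] && nonhiggs_cert l c
  | BadFactor d l P ss c =>
    [&& N.ltb 2 l, certified_prime l [::], dvdb l d & N.ltb 0 d] &&
    [&& N.ltb 1 P, N.eqb (N.add (powmod 2 (N.mul 2 d) P) 1) P,
        N.eqb (N.gcd (N.add (powmod 2 (N.mul 2 (N.div d l)) P) 1) P) 1,
        prime_cert (N.mul 4 l) P ss & nonhiggs_cert P c]
  end.

(** The gcd condition in [valid] says that no prime factor of [P] divides
    [2 ^ (2 * (d / l)) + 1], so that all of them are 1 modulo [4 * l]. *)
Lemma validP o n : valid o -> odd n -> N.to_nat (exponent o) %| n -> ~ H (2 * n).
Proof.
case: o => [l c|d l P ss c]; rewrite /valid /exponent.
  case/andP=> /certified_primeP l_pr /nonhiggs_certP l_bad n_odd ln hH.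
  exact/l_bad/(H_exponent_factor n_odd hH).
case/andP=> /and4P[/N.ltb_spec0 l_gt2 /certified_primeP l_pr ld /N.ltb_spec0 d_gt0].
case/and5P=> /N.ltb_spec0 P_gt1 /N.eqb_spec Epow /N.eqb_spec Egcd cert /nonhiggs_certP P_bad.
move=> n_odd dn hH; apply/P_bad.
have ED : N.to_nat (N.add (powmod 2 (N.mul 2 d) P) 1)
    = 2 ^ (2 * N.to_nat d) %% N.to_nat P + 1.
  by rewrite to_natD to_nat_powmod to_natM.
have PD : N.to_nat P %| 2 ^ (2 * N.to_nat d) + 1.
  by rewrite /dvdn -modnDml -ED Epow modnn.
have ldn := ld; rewrite dvdbE in ldn; have [e Ed] := dvdnP ldn.
have l_odd := dvdn_odd (dvdn_trans ldn dn) n_odd.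
have El : N.to_nat (N.div d l) = e.
  have lN0 : l <> N0 by move=> l0; rewrite l0 in l_pr.
  move: Ed; rewrite {1}(N.div_mod d l lN0); move: ld => /N.eqb_spec ->.
  rewrite N.add_0_r to_natM mulnC => /eqP; rewrite eqn_pmul2r ?prime_gt0 //.
  by move/eqP.
have e_gt0 : 0 < e by case: e Ed {El} => //; rewrite mul0n; lia.
have P_pr : prime (N.to_nat P).
  apply: (prime_certP _ _ _ cert) => [||r r_pr rP]; first by lia.
    by rewrite to_natM muln_gt0 (prime_gt0 l_pr).
  rewrite to_natM; apply: (@pred_prime_factor_4l r _ e) => //.
  - by rewrite [_ * e]mulnC -Ed (dvdn_trans rP).
  - apply/negP => rD.
    have : r %| N.to_nat (N.gcd (N.add (powmod 2 (N.mul 2 (N.div d l)) P) 1) P).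
      apply: dvdn_to_nat_gcd => //; rewrite to_natD to_nat_powmod to_natM El.
      by rewrite /dvdn -modnDml modn_dvdm // modnDml.
    by rewrite Egcd dvdn1 => /eqP r1; rewrite r1 in r_pr.
exact: H_factor n_odd hH dn P_pr PD.
Qed.

Lemma has_validP os n : all valid os -> odd n ->
  has (fun o => dvdb (exponent o) (N.of_nat n)) os -> ~ H (2 * n).
Proof.
move=> os_valid n_odd; elim: os os_valid => //= o os IHos /andP[o_valid /IHos IH].
by case/orP=> // on; apply: (validP o_valid n_odd); rewrite dvdbE Nat2N.id in on.
Qed.

(** * The range from 40000 to 45000 *)

Definition candidates : seq N := ([::
  40234; 40466; 40538; 40574; 40822; 40886; 41126; 41326; 41386; 41714; 41758;
  41878; 41898; 42134; 42314; 42358; 42646; 42766; 43058; 43154; 43322; 43402;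
  43574; 43634; 43642; 43678; 43786; 44054; 44186; 44294; 44378; 44518; 44582])%num.

(** The family only has to cover the range.  Entries that reach several [n] come
    first; each of the later ones reaches a single [n] that is not listed. *)
Definition obstructions : seq obstruction := ([::
  BadFactor 7 7 113 [::] [:: (2, [::])];
  BadFactor 11 11 2113 [::] [:: (2, [::])];
  BadExponent 17 [:: (2, [::])];
  BadFactor 19 19 525313 [::] [:: (2, [::])];
  BadFactor 25 5 8101 [::] [:: (3, [::])];
  BadFactor 27 3 246241 [::] [:: (2, [::])];
  BadFactor 29 29 107367629 [::] [:: (113, [::]); (2, [::])];
  BadFactor 37 37 593 [::] [:: (2, [::])];
  BadFactor 39 13 1249 [::] [:: (2, [::])];
  BadFactor 43 43 500177 [::] [:: (2, [::])];
  BadFactor 45 5 54001 [::] [:: (2, [::])];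
  BadFactor 47 47 3761 [::] [:: (2, [::])];
  BadFactor 53 53 15358129 [::] [:: (2, [::])];
  BadFactor 59 59 157649 [::] [:: (2, [::])];
  BadFactor 67 67 2559066073 [::] [:: (83761, [::]); (2, [::])];
  BadFactor 73 73 9929 [::] [:: (17, [::]); (2, [::])];
  BadFactor 71 71 148587949 [::] [:: (953, [::]); (17, [::]); (2, [::])];
  BadFactor 83 83 13063537 [::] [:: (2, [::])];
  BadFactor 79 79 381364611866507317969 [:: 36558773; 12503] [:: (2, [::])];
  BadExponent 97 [:: (2, [::])];
  BadExponent 113 [:: (2, [::])];
  BadExponent 103 [:: (17, [::]); (2, [::])];
  BadFactor 101 101 9491060093 [::] [:: (23492723, [:: 1067851; 113]); (1067851, [:: 113]); (113, [::]); (2, [::])];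
  BadFactor 131 131 269665073 [::] [:: (2, [::])];
  BadFactor 123 41 802333429 [::] [:: (17, [::]); (2, [::])];
  BadFactor 127 127 26417 [::] [:: (2, [::])];
  BadExponent 137 [:: (17, [::]); (2, [::])];
  BadFactor 139 139 1408349 [::] [:: (17, [::]); (2, [::])];
  BadFactor 151 151 130530323901899210670077 [:: 17142571871; 2621] [:: (17142571871, [:: 2621]); (654047, [:: 327023]); (327023, [::]); (113, [::]); (2, [::])];
  BadFactor 191 191 25212001 [::] [:: (2, [::])];
  BadExponent 193 [:: (2, [::])];
  BadExponent 241 [:: (2, [::])];
  BadExponent 227 [:: (113, [::]); (2, [::])];
  BadFactor 197 197 1079423677 [::] [:: (152203, [::]); (25367, [::]); (1153, [::]); (2, [::])];
  BadFactor 207 23 3313 [::] [:: (2, [::])];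
  BadFactor 183 61 5080081 [::] [:: (2, [::])];
  BadExponent 239 [:: (17, [::]); (2, [::])];
  BadFactor 229 229 6211454306149 [:: 33521] [:: (33521, [::]); (2, [::])];
  BadFactor 233 233 15576974348063186977 [:: 696395491240307; 1404709; 101] [:: (2, [::])];
  BadFactor 251 251 57762875981 [:: 31] [:: (371179, [::]); (17, [::]); (2, [::])];
  BadFactor 311 311 21149 [::] [:: (17, [::]); (2, [::])];
  BadFactor 313 313 42569 [::] [:: (17, [::]); (2, [::])];
  BadFactor 331 331 51861618869 [::] [:: (65393, [::]); (2, [::])];
  BadExponent 353 [:: (2, [::])];
  BadExponent 307 [:: (17, [::]); (2, [::])];
  BadFactor 367 367 92525303484856757 [:: 2287] [:: (130612831, [:: 4353761; 27211]); (4353761, [:: 27211]); (2, [::])];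
  BadExponent 337 [:: (2, [::])];
  BadFactor 359 359 585889 [::] [:: (2, [::])];
  BadFactor 521 521 16673 [::] [:: (2, [::])];
  BadFactor 523 523 8369 [::] [:: (2, [::])];
  BadFactor 541 541 1281089 [::] [:: (2, [::])];
  BadFactor 545 109 529741 [::] [:: (3, [::])];
  BadFactor 347 347 5575597 [::] [:: (103, [::]); (17, [::]); (2, [::])];
  BadExponent 673 [:: (2, [::])];
  BadFactor 691 691 11057 [::] [:: (2, [::])];
  BadFactor 879 293 70321 [::] [:: (2, [::])];
  BadExponent 881 [:: (2, [::])];
  BadExponent 977 [:: (2, [::])];
  BadFactor 509 509 103837 [::] [:: (17, [::]); (2, [::])];
  BadExponent 647 [:: (17, [::]); (2, [::])];
  BadFactor 669 223 454921 [::] [:: (17, [::]); (2, [::])];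
  BadFactor 877 877 178909 [::] [:: (17, [::]); (2, [::])];
  BadExponent 953 [:: (17, [::]); (2, [::])];
  BadFactor 967 967 328781 [::] [:: (17, [::]); (2, [::])];
  BadFactor 659 659 1534153 [::] [:: (97, [::]); (2, [::])];
  BadExponent 971 [:: (97, [::]); (2, [::])];
  BadExponent 653 [:: (163, [::]); (3, [::])];
  BadExponent 887 [:: (443, [::]); (17, [::]); (2, [::])];
  BadFactor 701 701 1649929681 [::] [:: (2, [::])];
  BadFactor 961 31 864219613 [::] [:: (74941, [::]); (1249, [::]); (2, [::])];
  BadFactor 503 503 350862114989 [:: 7] [:: (2264737, [:: 761]); (2, [::])];
  BadFactor 719 719 980996410232957 [:: 97] [:: (97, [::]); (2, [::])];
  BadFactor 709 709 536490644259457 [:: 656845817; 94483] [:: (2, [::])];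
  BadFactor 683 683 59655406504682930077 [:: 241939] [:: (241939, [::]); (13441, [::]); (2, [::])];
  BadFactor 905 181 62984381 [::] [:: (137, [::]); (17, [::]); (2, [::])];
  BadFactor 911 911 29153 [::] [:: (2, [::])];
  BadExponent 919 [:: (17, [::]); (2, [::])];
  BadExponent 929 [:: (2, [::])];
  BadFactor 947 947 1440383213 [::] [:: (239, [::]); (17, [::]); (2, [::])];
  BadFactor 951 317 15217 [::] [:: (2, [::])];
  BadExponent 1361 [:: (2, [::])];
  BadFactor 1381 1381 17036017 [::] [:: (2, [::])];
  BadFactor 1399 1399 1163969 [::] [:: (2, [::])];
  BadExponent 1409 [:: (2, [::])];
  BadExponent 1429 [:: (17, [::]); (2, [::])];
  BadExponent 1447 [:: (241, [::]); (2, [::])];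
  BadExponent 1459 [:: (3, [::])];
  BadFactor 1471 1471 23537 [::] [:: (2, [::])];
  BadFactor 1481 1481 3424073 [::] [:: (17, [::]); (2, [::])];
  BadExponent 1489 [:: (2, [::])];
  BadFactor 1493 1493 47777 [::] [:: (2, [::])];
  BadExponent 1543 [:: (257, [::]); (2, [::])];
  BadExponent 1553 [:: (2, [::])];
  BadFactor 1559 1559 34925072803457 [:: 1733] [:: (2, [::])];
  BadFactor 1567 1567 75217 [::] [:: (2, [::])];
  BadFactor 1579 1579 287694072920677 [:: 15183347737; 632639489; 109] [:: (15183347737, [:: 632639489; 109]); (632639489, [:: 109]); (2, [::])];
  BadExponent 1583 [:: (113, [::]); (2, [::])];
  BadFactor 1585 317 40271681 [::] [:: (2, [::])];
  BadFactor 1597 1597 19362029 [::] [:: (433, [::]); (2, [::])];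
  BadExponent 1601 [:: (2, [::])];
  BadFactor 1607 1607 668513 [::] [:: (2, [::])];
  BadFactor 1609 1609 5702297 [::] [:: (443, [::]); (17, [::]); (2, [::])];
  BadFactor 1613 1613 5160866164857057845681 [:: 34582349; 8645587; 239] [:: (2, [::])];
  BadFactor 1619 1619 8392897 [::] [:: (2, [::])];
  BadExponent 1621 [:: (3, [::])];
  BadExponent 1637 [:: (409, [::]); (17, [::]); (2, [::])];
  BadFactor 1657 1657 26513 [::] [:: (2, [::])];
  BadFactor 1663 1663 266081 [::] [:: (2, [::])];
  BadExponent 1667 [:: (17, [::]); (2, [::])];
  BadExponent 1697 [:: (2, [::])];
  BadFactor 1709 1709 35568209416658236003782498459516841 [:: 1938108481343; 88095840061; 22993] [:: (52864459, [:: 709]); (17, [::]); (2, [::])];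
  BadFactor 1721 1721 85967393 [::] [:: (2, [::])];
  BadFactor 1723 1723 2099331561841897633 [:: 7573] [:: (2, [::])];
  BadFactor 2237 2237 393713 [::] [:: (2, [::])];
  BadFactor 2243 2243 71777 [::] [:: (2, [::])];
  BadExponent 2267 [:: (103, [::]); (17, [::]); (2, [::])];
  BadExponent 2269 [:: (3, [::])];
  BadExponent 2273 [:: (2, [::])];
  BadFactor 2287 2287 180361969 [::] [:: (2, [::])];
  BadExponent 2309 [:: (577, [::]); (2, [::])];
  BadFactor 2339 2339 111177349 [::] [:: (17, [::]); (2, [::])];
  BadFactor 2341 2341 1161137 [::] [:: (2, [::])];
  BadExponent 2347 [:: (17, [::]); (2, [::])];
  BadFactor 2351 2351 19936481 [::] [:: (2, [::])];
  BadFactor 2357 2357 8572908156604109897 [:: 1697] [:: (1697, [::]); (2, [::])];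
  BadFactor 2371 2371 493169 [::] [:: (2, [::])];
  BadExponent 2381 [:: (17, [::]); (2, [::])];
  BadFactor 2399 2399 115153 [::] [:: (2, [::])];
  BadExponent 2411 [:: (241, [::]); (2, [::])];
  BadExponent 2417 [:: (2, [::])];
  BadFactor 2437 2437 127620817 [::] [:: (2, [::])];
  BadExponent 2459 [:: (1229, [::]); (307, [::]); (17, [::]); (2, [::])];
  BadExponent 2467 [:: (137, [::]); (17, [::]); (2, [::])];
  BadExponent 2473 [:: (103, [::]); (17, [::]); (2, [::])];
  BadExponent 2477 [:: (619, [::]); (103, [::]); (17, [::]); (2, [::])];
  BadExponent 4001 [:: (2, [::])];
  BadFactor 4007 4007 41143877 [::] [:: (17, [::]); (2, [::])];
  BadExponent 4013 [:: (17, [::]); (2, [::])];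
  BadFactor 4027 4027 64433 [::] [:: (2, [::])];
  BadExponent 4049 [:: (2, [::])];
  BadExponent 4051 [:: (3, [::])];
  BadFactor 4057 4057 5517521 [::] [:: (2, [::])];
  BadFactor 4073 4073 391009 [::] [:: (2, [::])];
  BadFactor 4079 4079 2284241 [::] [:: (2, [::])];
  BadExponent 4091 [:: (409, [::]); (17, [::]); (2, [::])];
  BadExponent 4111 [:: (137, [::]); (17, [::]); (2, [::])];
  BadFactor 4119 1373 21418801 [::] [:: (2, [::])];
  BadExponent 4127 [:: (2063, [::]); (1031, [::]); (103, [::]); (17, [::]); (2, [::])];
  BadExponent 4129 [:: (2, [::])];
  BadFactor 4133 4133 7400704853629 [::] [:: (3, [::])];
  BadFactor 4139 4139 927137 [::] [:: (2, [::])];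
  BadFactor 4157 4157 25966488579051843297733 [:: 4606525826475271; 64747621; 2447] [:: (113, [::]); (2, [::])];
  BadFactor 4159 4159 3703040513 [::] [:: (2, [::])];
  BadExponent 4177 [:: (2, [::])];
  BadFactor 4201 4201 4100177 [::] [:: (2, [::])];
  BadExponent 4217 [:: (17, [::]); (2, [::])];
  BadExponent 4241 [:: (2, [::])];
  BadFactor 4253 4253 43822913 [::] [:: (2, [::])];
  BadExponent 4259 [:: (2129, [::]); (2, [::])];
  BadFactor 4261 4261 50789362452246497237 [:: 6451] [:: (1327, [::]); (17, [::]); (2, [::])];
  BadFactor 4269 1423 125252461 [::] [:: (163, [::]); (3, [::])];
  BadExponent 4273 [:: (2, [::])];
  BadFactor 4281 1427 136993 [::] [:: (2, [::])];
  BadFactor 4283 4283 5276657 [::] [:: (2, [::])];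
  BadExponent 4289 [:: (2, [::])];
  BadFactor 4317 1439 69073 [::] [:: (2, [::])];
  BadExponent 4327 [:: (103, [::]); (17, [::]); (2, [::])];
  BadExponent 4337 [:: (2, [::])];
  BadExponent 4339 [:: (241, [::]); (2, [::])];
  BadFactor 4349 4349 139169 [::] [:: (2, [::])];
  BadFactor 4363 4363 44781833 [::] [:: (1283, [::]); (641, [::]); (2, [::])];
  BadFactor 4387 41 8291008849 [:: 107] [:: (2, [::])];
  BadFactor 4391 4391 25643441 [::] [:: (2, [::])];
  BadFactor 4397 4397 222822373 [::] [:: (103, [::]); (17, [::]); (2, [::])];
  BadExponent 4421 [:: (17, [::]); (2, [::])];
  BadFactor 4423 4423 70769 [::] [:: (2, [::])];
  BadFactor 4441 4441 6021997 [::] [:: (113, [::]); (2, [::])];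
  BadFactor 4447 4447 103383857 [::] [:: (2, [::])];
  BadFactor 4449 1483 213553 [::] [:: (2, [::])];
  BadFactor 4457 4457 13774716860629 [::] [:: (257548367, [:: 128774183; 64387091; 431]); (128774183, [:: 64387091; 431]); (64387091, [:: 431]); (14939, [::]); (97, [::]); (2, [::])];
  BadExponent 4463 [:: (97, [::]); (2, [::])];
  BadExponent 4481 [:: (2, [::])];
  BadExponent 4493 [:: (1123, [::]); (17, [::]); (2, [::])];
  BadFactor 4497 1499 74831087329 [::] [:: (2, [::])];
  BadExponent 6673 [:: (2, [::])];
  BadFactor 6679 6679 38951929 [::] [:: (3, [::])];
  BadExponent 6689 [:: (2, [::])];
  BadFactor 6703 6703 107739544397 [::] [:: (365303, [::]); (97, [::]); (2, [::])];
  BadFactor 6709 6709 990033713 [::] [:: (2, [::])];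
  BadExponent 6733 [:: (17, [::]); (2, [::])];
  BadExponent 6737 [:: (2, [::])];
  BadFactor 6753 2251 35088589 [::] [:: (433, [::]); (2, [::])];
  BadFactor 6763 6763 180166321 [::] [:: (2, [::])];
  BadExponent 6781 [:: (113, [::]); (2, [::])];
  BadExponent 6791 [:: (97, [::]); (2, [::])];
  BadFactor 6793 6793 1086881 [::] [:: (2, [::])];
  BadFactor 6803 6803 13061761 [::] [:: (2, [::])];
  BadFactor 6823 6823 109169 [::] [:: (2, [::])];
  BadFactor 6827 6827 4642361 [::] [:: (17, [::]); (2, [::])];
  BadFactor 6829 6829 7867009 [::] [:: (2, [::])];
  BadExponent 6833 [:: (2, [::])];
  BadFactor 6835 1367 2252023141 [::] [:: (27457, [::]); (2, [::])];
  BadFactor 6863 6863 2855009 [::] [:: (2, [::])];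
  BadExponent 6869 [:: (17, [::]); (2, [::])];
  BadFactor 6871 6871 2458718641 [::] [:: (2, [::])];
  BadFactor 6879 2293 962001652093 [::] [:: (17, [::]); (2, [::])];
  BadFactor 6883 6883 110129 [::] [:: (2, [::])];
  BadFactor 6891 2297 2756401 [::] [:: (2, [::])];
  BadFactor 6899 6899 1407397 [::] [:: (17, [::]); (2, [::])];
  BadFactor 6907 6907 18423980453 [::] [:: (17, [::]); (2, [::])];
  BadFactor 6911 6911 21120017 [::] [:: (2, [::])];
  BadFactor 6917 6917 1502710779641 [::] [:: (775889, [:: 683]); (2, [::])];
  BadFactor 6933 3 15788858765583949 [:: 51757925749; 139134209; 397] [:: (51757925749, [:: 139134209; 397]); (139134209, [:: 397]); (2, [::])];
  BadExponent 6949 [:: (193, [::]); (2, [::])];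
  BadExponent 6961 [:: (2, [::])];
  BadExponent 6967 [:: (3, [::])];
  BadExponent 6971 [:: (17, [::]); (2, [::])];
  BadExponent 6977 [:: (2, [::])];
  BadFactor 6991 6991 782993 [::] [:: (2, [::])];
  BadFactor 6997 6997 335857 [::] [:: (2, [::])];
  BadFactor 7001 7001 560081 [::] [:: (2, [::])];
  BadFactor 7013 7013 250051226899049 [:: 61] [:: (17, [::]); (2, [::])];
  BadFactor 7019 7019 148718573 [::] [:: (5297, [::]); (2, [::])];
  BadFactor 7027 7027 75498089 [::] [:: (17, [::]); (2, [::])];
  BadExponent 7039 [:: (17, [::]); (2, [::])];
  BadExponent 7057 [:: (2, [::])];
  BadFactor 7069 7069 1098514179294097 [:: 151] [:: (2, [::])];
  BadFactor 7079 7079 481373 [::] [:: (17, [::]); (2, [::])];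
  BadExponent 7109 [:: (1777, [::]); (2, [::])];
  BadExponent 7121 [:: (2, [::])];
  BadFactor 7127 7127 5473537 [::] [:: (2, [::])];
  BadExponent 7129 [:: (3, [::])];
  BadFactor 7131 2377 212446753 [::] [:: (2, [::])];
  BadFactor 7159 7159 2061793 [::] [:: (2, [::])];
  BadFactor 7167 2389 7797697 [::] [:: (2, [::])];
  BadFactor 7177 7177 114833 [::] [:: (2, [::])];
  BadFactor 7179 2393 1952689 [::] [:: (2, [::])];
  BadExponent 7187 [:: (3593, [::]); (449, [::]); (2, [::])];
  BadFactor 7193 7193 11024106889 [::] [:: (3361, [::]); (2, [::])];
  BadExponent 7207 [:: (1201, [::]); (2, [::])];
  BadExponent 7211 [:: (103, [::]); (17, [::]); (2, [::])];
  BadFactor 7213 7213 45326213882559749 [:: 79] [:: (19885953931, [:: 10039]); (10039, [::]); (239, [::]); (17, [::]); (2, [::])];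
  BadExponent 7219 [:: (401, [::]); (2, [::])];
  BadFactor 7237 7237 115793 [::] [:: (2, [::])];
  BadExponent 7243 [:: (17, [::]); (2, [::])];
  BadFactor 7247 7247 7163278615172609616859937 [:: 2636197; 219683] [:: (2, [::])];
  BadFactor 7255 1451 2205521 [::] [:: (2, [::])];
  BadFactor 7283 7283 21557681 [::] [:: (2, [::])];
  BadExponent 7297 [:: (2, [::])];
  BadFactor 7307 7307 350737 [::] [:: (2, [::])];
  BadFactor 7341 2447 352369 [::] [:: (2, [::])];
  BadExponent 7369 [:: (307, [::]); (17, [::]); (2, [::])];
  BadExponent 7393 [:: (2, [::])];
  BadFactor 7411 7411 2875469 [::] [:: (97, [::]); (2, [::])];
  BadExponent 7417 [:: (103, [::]); (17, [::]); (2, [::])];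
  BadExponent 7433 [:: (929, [::]); (2, [::])];
  BadFactor 7451 7451 159600421 [::] [:: (17, [::]); (2, [::])];
  BadExponent 7457 [:: (2, [::])];
  BadExponent 7459 [:: (113, [::]); (2, [::])];
  BadFactor 7477 7477 1105497425086337 [:: 19] [:: (2, [::])];
  BadExponent 7481 [:: (17, [::]); (2, [::])];
  BadExponent 7489 [:: (2, [::])];
  BadExponent 7499 [:: (163, [::]); (3, [::])];
  BadFactor 20011 20011 401987096437347709 [:: 349] [:: (57041, [::]); (2, [::])];
  BadFactor 20015 4003 1361021 [::] [:: (17, [::]); (2, [::])];
  BadFactor 20021 20021 8951789521 [::] [:: (2, [::])];
  BadFactor 20023 20023 90961198091722709 [:: 6091] [:: (4547729, [:: 284233]); (2, [::])];
  BadFactor 20029 20029 887760917916181 [:: 479] [:: (479, [::]); (239, [::]); (17, [::]); (2, [::])];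
  BadExponent 20047 [:: (257, [::]); (2, [::])];
  BadExponent 20051 [:: (401, [::]); (2, [::])];
  BadFactor 20063 20063 16907977285861 [::] [:: (1489, [::]); (2, [::])];
  BadFactor 20071 20071 4993664801 [::] [:: (2, [::])];
  BadFactor 20073 6691 614410843861 [::] [:: (3, [::])];
  BadExponent 20089 [:: (3, [::])];
  BadFactor 20095 4019 203199415330321 [:: 8431] [:: (2, [::])];
  BadFactor 20101 20101 320651153 [::] [:: (2, [::])];
  BadFactor 20103 6701 4637203879897 [::] [:: (3, [::])];
  BadFactor 20105 4021 85566881 [::] [:: (2, [::])];
  BadFactor 20107 20107 1295939500693 [::] [:: (163, [::]); (3, [::])];
  BadExponent 20113 [:: (2, [::])];
  BadFactor 20123 20123 3859430417 [::] [:: (2, [::])];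
  BadExponent 20129 [:: (2, [::])];
  BadFactor 20131 491 322097 [::] [:: (2, [::])];
  BadFactor 20137 1549 1164724081 [::] [:: (2, [::])];
  BadFactor 20143 20143 3222881 [::] [:: (2, [::])];
  BadFactor 20147 20147 1611761 [::] [:: (2, [::])];
  BadFactor 20149 20149 63420906645857 [::] [:: (2, [::])];
  BadFactor 20151 2239 12388592989 [::] [:: (17, [::]); (2, [::])];
  BadFactor 20157 6719 1758772589017 [::] [:: (2819, [::]); (1409, [::]); (2, [::])];
  BadExponent 20161 [:: (2, [::])];
  BadFactor 20173 20173 11120318483160221 [:: 29599] [:: (29599, [::]); (4933, [::]); (137, [::]); (17, [::]); (2, [::])];
  BadExponent 20177 [:: (2, [::])];
  BadExponent 20183 [:: (10091, [::]); (1009, [::]); (2, [::])];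
  BadFactor 20201 20201 1343689717 [::] [:: (241, [::]); (2, [::])];
  BadExponent 20219 [:: (919, [::]); (17, [::]); (2, [::])];
  BadExponent 20231 [:: (17, [::]); (2, [::])];
  BadFactor 20249 20249 917765677 [::] [:: (1259, [::]); (17, [::]); (2, [::])];
  BadFactor 20261 20261 4985018450620597 [:: 307] [:: (307, [::]); (17, [::]); (2, [::])];
  BadFactor 20283 6761 10384897 [::] [:: (2, [::])];
  BadFactor 20297 20297 4871281 [::] [:: (2, [::])];
  BadFactor 20309 883 19876073534417 [:: 61] [:: (2, [::])];
  BadFactor 20323 20323 164343646633 [::] [:: (30631, [::]); (1021, [::]); (17, [::]); (2, [::])];
  BadFactor 20327 20327 111565299468197 [::] [:: (196018841, [:: 2551]); (17, [::]); (2, [::])];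
  BadExponent 20333 [:: (17, [::]); (2, [::])];
  BadFactor 20337 6779 21963961 [::] [:: (3, [::])];
  BadExponent 20341 [:: (113, [::]); (2, [::])];
  BadExponent 20347 [:: (3391, [::]); (113, [::]); (2, [::])];
  BadExponent 20353 [:: (2, [::])];
  BadFactor 20357 20357 17874389669093 [::] [:: (643729, [:: 13411]); (2, [::])];
  BadFactor 20359 20359 165584633161 [::] [:: (67777, [::]); (2, [::])];
  BadExponent 20369 [:: (2, [::])];
  BadFactor 20389 20389 5917050913 [::] [:: (2, [::])];
  BadFactor 20393 20393 31115313113 [::] [:: (17, [::]); (2, [::])];
  BadFactor 20399 20399 21718290392933 [::] [:: (809023, [:: 134837]); (134837, [::]); (2593, [::]); (2, [::])];
  BadFactor 20407 20407 245210513 [::] [:: (2, [::])];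
  BadFactor 20423 1571 4901521 [::] [:: (2, [::])];
  BadExponent 20431 [:: (227, [::]); (113, [::]); (2, [::])];
  BadFactor 20441 20441 1518847878931274201 [:: 18041] [:: (31249, [::]); (2, [::])];
  BadFactor 20459 499 193378469 [::] [:: (17, [::]); (2, [::])];
  BadFactor 20465 4093 1823185921 [::] [:: (2, [::])];
  BadFactor 20477 20477 48848620673 [::] [:: (2, [::])];
  BadFactor 20479 20479 21953489 [::] [:: (2, [::])];
  BadFactor 20483 20483 209150765953 [::] [:: (2, [::])];
  BadFactor 20491 661 17048513 [::] [:: (2, [::])];
  BadFactor 20495 4099 4854020305781 [::] [:: (641, [::]); (2, [::])];
  BadFactor 20507 20507 984337 [::] [:: (2, [::])];
  BadFactor 20509 20509 381598821673 [::] [:: (775267, [:: 157]); (823, [::]); (137, [::]); (17, [::]); (2, [::])];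
  BadFactor 20521 20521 10603089092191049 [:: 47] [:: (1374187663, [:: 467]); (163477, [::]); (239, [::]); (17, [::]); (2, [::])];
  BadFactor 20523 6841 35639340265657 [::] [:: (35591, [::]); (3559, [::]); (593, [::]); (2, [::])];
  BadFactor 20529 2281 90710260561 [::] [:: (2, [::])];
  BadFactor 20533 20533 11169953 [::] [:: (2, [::])];
  BadFactor 20543 20543 68038417 [::] [:: (2, [::])];
  BadFactor 20549 20549 4602977 [::] [:: (2, [::])];
  BadExponent 20551 [:: (137, [::]); (17, [::]); (2, [::])];
  BadFactor 20571 6857 632794816501 [::] [:: (17, [::]); (2, [::])];
  BadFactor 20585 179 4199341 [::] [:: (17, [::]); (2, [::])];
  BadExponent 20593 [:: (2, [::])];
  BadFactor 20599 20599 4284593 [::] [:: (2, [::])];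
  BadFactor 20611 20611 419783134888609 [::] [:: (2, [::])];
  BadFactor 20627 20627 177451688269 [::] [:: (17, [::]); (2, [::])];
  BadExponent 20639 [:: (17, [::]); (2, [::])];
  BadExponent 20641 [:: (2, [::])];
  BadFactor 20681 20681 11998288961 [::] [:: (2, [::])];
  BadExponent 20707 [:: (17, [::]); (2, [::])];
  BadFactor 20717 20717 4666855941793 [::] [:: (2, [::])];
  BadFactor 20719 20719 524439329 [::] [:: (2, [::])];
  BadFactor 20731 20731 3625345887387163393 [:: 6373] [:: (2, [::])];
  BadExponent 20743 [:: (3457, [::]); (2, [::])];
  BadFactor 20747 20747 4587457859275601 [:: 359] [:: (2, [::])];
  BadFactor 20749 20749 2987857 [::] [:: (2, [::])];
  BadExponent 20753 [:: (2, [::])];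
  BadExponent 20759 [:: (97, [::]); (2, [::])];
  BadFactor 20765 4153 266824601921 [::] [:: (2, [::])];
  BadFactor 20771 20771 11631761 [::] [:: (2, [::])];
  BadExponent 20773 [:: (577, [::]); (2, [::])];
  BadExponent 20789 [:: (5197, [::]); (433, [::]); (2, [::])];
  BadExponent 20807 [:: (103, [::]); (17, [::]); (2, [::])];
  BadExponent 20809 [:: (17, [::]); (2, [::])];
  BadFactor 20841 6947 241721332394161 [:: 419] [:: (2, [::])];
  BadExponent 20849 [:: (2, [::])];
  BadFactor 20861 907 11682161 [::] [:: (2, [::])];
  BadExponent 20873 [:: (2609, [::]); (2, [::])];
  BadFactor 20877 6959 2939122849633 [::] [:: (2, [::])];
  BadFactor 20887 20887 1413241979494348697 [:: 4229] [:: (30449, [::]); (2, [::])];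
  BadExponent 20897 [:: (2, [::])];
  BadExponent 20899 [:: (3, [::])];
  BadFactor 20903 20903 12815629301 [::] [:: (6131, [::]); (613, [::]); (17, [::]); (2, [::])];
  BadFactor 20921 20921 138047134817 [::] [:: (2, [::])];
  BadExponent 20929 [:: (2, [::])];
  BadFactor 20947 20947 4356977 [::] [:: (2, [::])];
  BadFactor 20959 20959 32528369 [::] [:: (2, [::])];
  BadFactor 20963 20963 242751541 [::] [:: (193, [::]); (2, [::])];
  BadFactor 20981 20981 107674493 [::] [:: (1283, [::]); (641, [::]); (2, [::])];
  BadFactor 20983 20983 335729 [::] [:: (2, [::])];
  BadFactor 20987 677 4696051121 [::] [:: (2, [::])];
  BadFactor 20997 2333 343174969 [::] [:: (3, [::])];
  BadFactor 21001 21001 143142817 [::] [:: (2, [::])];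
  BadFactor 21011 21011 2588733405889073 [:: 107] [:: (2, [::])];
  BadExponent 21013 [:: (17, [::]); (2, [::])];
  BadFactor 21017 21017 1008817 [::] [:: (2, [::])];
  BadExponent 21019 [:: (113, [::]); (2, [::])];
  BadFactor 21023 21023 98167453170833 [::] [:: (2, [::])];
  BadFactor 21031 21031 3364961 [::] [:: (2, [::])];
  BadFactor 21055 4211 247639477361 [::] [:: (2, [::])];
  BadExponent 21059 [:: (10529, [::]); (2, [::])];
  BadExponent 21061 [:: (3, [::])];
  BadExponent 21089 [:: (2, [::])];
  BadFactor 21095 4219 246454741361 [::] [:: (2, [::])];
  BadFactor 21101 21101 20379061618231109 [:: 31] [:: (26048833, [:: 135671]); (2, [::])];
  BadFactor 21107 21107 13677337 [::] [:: (3, [::])];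
  BadExponent 21121 [:: (2, [::])];
  BadFactor 21129 7043 39663527833 [::] [:: (17, [::]); (2, [::])];
  BadFactor 21139 21139 612439109 [::] [:: (7243, [::]); (17, [::]); (2, [::])];
  BadFactor 21143 21143 5812514820913 [::] [:: (2, [::])];
  BadFactor 21145 4229 128318686241 [::] [:: (2, [::])];
  BadExponent 21149 [:: (17, [::]); (2, [::])];
  BadFactor 21151 1627 494425777 [::] [:: (2, [::])];
  BadFactor 21155 4231 676961 [::] [:: (2, [::])];
  BadFactor 21163 21163 24633733 [::] [:: (97, [::]); (2, [::])];
  BadExponent 21169 [:: (2, [::])];
  BadFactor 21187 21187 7004761193 [::] [:: (17, [::]); (2, [::])];
  BadExponent 21191 [:: (163, [::]); (3, [::])];
  BadFactor 21193 21193 13578585171716633 [:: 193] [:: (163, [::]); (3, [::])];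
  BadFactor 21211 21211 44090894791769069 [:: 519670156897; 54679099; 191] [:: (519670156897, [:: 54679099; 191]); (2, [::])];
  BadFactor 21215 4243 10883804161 [::] [:: (2, [::])];
  BadFactor 21221 21221 86799381987654464881 [:: 18911] [:: (2, [::])];
  BadFactor 21227 21227 629548586308281713 [:: 1170397; 10837] [:: (2, [::])];
  BadFactor 21247 21247 3696298097 [::] [:: (2, [::])];
  BadExponent 21269 [:: (409, [::]); (17, [::]); (2, [::])];
  BadFactor 21277 21277 108822663337 [::] [:: (103, [::]); (17, [::]); (2, [::])];
  BadFactor 21283 21283 38649929 [::] [:: (227, [::]); (113, [::]); (2, [::])];
  BadFactor 21289 349 4428113 [::] [:: (2, [::])];
  BadFactor 21293 107 23528569104401 [:: 41231] [:: (2, [::])];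
  BadFactor 21309 7103 1226375569 [::] [:: (2, [::])];
  BadExponent 21313 [:: (2, [::])];
  BadFactor 21317 21317 113065369 [::] [:: (17, [::]); (2, [::])];
  BadExponent 21319 [:: (17, [::]); (2, [::])];
  BadExponent 21341 [:: (97, [::]); (2, [::])];
  BadFactor 21347 21347 1835073509 [::] [:: (21491, [::]); (307, [::]); (17, [::]); (2, [::])];
  BadFactor 21355 4271 341681 [::] [:: (2, [::])];
  BadExponent 21377 [:: (2, [::])];
  BadFactor 21379 21379 288704060687561 [::] [:: (48228913, [:: 111641]); (2, [::])];
  BadFactor 21391 21391 342257 [::] [:: (2, [::])];
  BadExponent 21397 [:: (1783, [::]); (3, [::])];
  BadFactor 21401 21401 7634266499589138133 [:: 13877] [:: (241, [::]); (2, [::])];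
  BadFactor 21407 21407 143980056881 [::] [:: (2, [::])];
  BadFactor 21419 21419 50949118273 [::] [:: (2, [::])];
  BadFactor 21433 21433 340795330769 [::] [:: (2, [::])];
  BadFactor 21447 2383 42443784577 [::] [:: (2, [::])];
  BadFactor 21453 7151 5148721 [::] [:: (2, [::])];
  BadFactor 21467 21467 3992862001 [::] [:: (2, [::])];
  BadFactor 21481 21481 187987357012165829 [:: 23] [:: (7317167003, [:: 3658583501; 51169]); (3658583501, [:: 51169]); (51169, [::]); (2, [::])];
  BadFactor 21485 4297 156125594187721 [:: 113] [:: (113, [::]); (2, [::])];
  BadFactor 21487 21487 9887844342209 [::] [:: (2, [::])];
  BadExponent 21491 [:: (307, [::]); (17, [::]); (2, [::])];
  BadFactor 21493 21493 38970722789329 [::] [:: (2, [::])];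
  BadFactor 21495 1433 73326151441 [::] [:: (2, [::])];
  BadFactor 21499 21499 6172964873 [::] [:: (1889, [::]); (2, [::])];
  BadFactor 21503 21503 688097 [::] [:: (2, [::])];
  BadExponent 21517 [:: (163, [::]); (3, [::])];
  BadExponent 21521 [:: (2, [::])];
  BadExponent 21523 [:: (17, [::]); (2, [::])];
  BadFactor 21551 937 12413377 [::] [:: (2, [::])];
  BadExponent 21557 [:: (17, [::]); (2, [::])];
  BadExponent 21559 [:: (3593, [::]); (449, [::]); (2, [::])];
  BadFactor 21563 21563 518164407417814927837 [:: 64808612669; 782297; 97787] [:: (64808612669, [:: 782297; 97787]); (782297, [:: 97787]); (97787, [::]); (3761, [::]); (2, [::])];
  BadExponent 21569 [:: (2, [::])];
  BadFactor 21587 21587 194455697 [::] [:: (2, [::])];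
  BadExponent 21589 [:: (257, [::]); (2, [::])];
  BadFactor 21599 21599 1506400657 [::] [:: (2, [::])];
  BadExponent 21601 [:: (2, [::])];
  BadExponent 21611 [:: (2161, [::]); (2, [::])];
  BadFactor 21613 21613 501421601 [::] [:: (2, [::])];
  BadExponent 21617 [:: (2, [::])];
  BadFactor 21643 941 6470044993 [::] [:: (2, [::])];
  BadExponent 21647 [:: (137, [::]); (17, [::]); (2, [::])];
  BadExponent 21649 [:: (2, [::])];
  BadFactor 21673 21673 1473647832721 [::] [:: (2, [::])];
  BadFactor 21683 21683 2643600384030941 [:: 23] [:: (265044383, [:: 7795423; 433079]); (17, [::]); (2, [::])];
  BadFactor 21687 7229 174419092928329 [:: 4057] [:: (247799, [::]); (6521, [::]); (163, [::]); (3, [::])];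
  BadFactor 21689 41 519494929 [::] [:: (2, [::])];
  BadFactor 21691 199 347057 [::] [:: (2, [::])];
  BadFactor 21697 1669 68425742113 [::] [:: (2, [::])];
  BadExponent 21713 [:: (2, [::])];
  BadExponent 21727 [:: (17, [::]); (2, [::])];
  BadFactor 21737 21737 1043377 [::] [:: (2, [::])];
  BadFactor 21739 21739 8790238214777 [::] [:: (307, [::]); (17, [::]); (2, [::])];
  BadFactor 21751 21751 160174189993 [::] [:: (17, [::]); (2, [::])];
  BadFactor 21757 21757 3755432257 [::] [:: (2, [::])];
  BadFactor 21759 7253 2437009 [::] [:: (2, [::])];
  BadExponent 21767 [:: (10883, [::]); (5441, [::]); (2, [::])];
  BadFactor 21773 21773 428007189193 [::] [:: (3919, [::]); (653, [::]); (163, [::]); (3, [::])];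
  BadFactor 21785 4357 697121 [::] [:: (2, [::])];
  BadFactor 21795 1453 17784721 [::] [:: (2, [::])];
  BadFactor 21799 21799 176078981709569 [::] [:: (2, [::])];
  BadFactor 21803 21803 10116593 [::] [:: (2, [::])];
  BadFactor 21807 2423 328159358506009 [:: 151] [:: (17, [::]); (2, [::])];
  BadExponent 21841 [:: (2, [::])];
  BadFactor 21851 21851 107419517 [::] [:: (1229, [::]); (307, [::]); (17, [::]); (2, [::])];
  BadFactor 21853 41 3146833 [::] [:: (2, [::])];
  BadFactor 21859 21859 12033797688725929 [:: 36871] [:: (36871, [::]); (1229, [::]); (307, [::]); (17, [::]); (2, [::])];
  BadExponent 21863 [:: (17, [::]); (2, [::])];
  BadFactor 21865 4373 349841 [::] [:: (2, [::])];
  BadExponent 21871 [:: (3, [::])];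
  BadFactor 21881 21881 868588177 [::] [:: (2, [::])];
  BadFactor 21911 21911 533154052633 [::] [:: (17, [::]); (2, [::])];
  BadFactor 21927 7309 1284655216849 [::] [:: (2, [::])];
  BadExponent 21929 [:: (2741, [::]); (137, [::]); (17, [::]); (2, [::])];
  BadExponent 21937 [:: (2, [::])];
  BadFactor 21943 21943 5606875361 [::] [:: (2, [::])];
  BadFactor 21961 21961 3948903774869 [::] [:: (3457969, [:: 1181]); (2, [::])];
  BadFactor 21963 7321 1151684461093 [::] [:: (1191761, [:: 14897]); (2, [::])];
  BadFactor 21969 2441 481560481 [::] [:: (2, [::])];
  BadFactor 21977 21977 23119100737 [::] [:: (2, [::])];
  BadFactor 21991 21991 394958529518239249 [:: 37] [:: (2, [::])];
  BadFactor 21993 7331 90395540629 [::] [:: (1027549, [:: 73]); (17, [::]); (2, [::])];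
  BadFactor 21997 21997 3815159681 [::] [:: (2, [::])];
  BadFactor 21999 7333 251246355193 [::] [:: (433, [::]); (2, [::])];
  BadExponent 22003 [:: (193, [::]); (2, [::])];
  BadFactor 22009 1693 149309057 [::] [:: (2, [::])];
  BadFactor 22013 22013 56744413499849 [::] [:: (10394227, [:: 577457]); (577457, [::]); (2, [::])];
  BadFactor 22031 22031 704993 [::] [:: (2, [::])];
  BadFactor 22037 22037 3189582491201 [::] [:: (2, [::])];
  BadExponent 22039 [:: (3673, [::]); (17, [::]); (2, [::])];
  BadFactor 22045 4409 1073266821241 [::] [:: (6481, [::]); (2, [::])];
  BadFactor 22047 7349 48403717487893 [::] [:: (14073581, [:: 703679; 193]); (703679, [:: 193]); (193, [::]); (2, [::])];
  BadFactor 22051 22051 13114095658397 [::] [:: (11489, [::]); (2, [::])];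
  BadFactor 22053 7351 86271337 [::] [:: (163, [::]); (3, [::])];
  BadExponent 22063 [:: (3677, [::]); (919, [::]); (17, [::]); (2, [::])];
  BadExponent 22067 [:: (17, [::]); (2, [::])];
  BadFactor 22073 22073 348405528093588528713 [:: 116060587760129; 65983] [:: (17, [::]); (2, [::])];
  BadFactor 22079 22079 204969071761 [::] [:: (2, [::])];
  BadFactor 22087 1699 2361630389 [::] [:: (26731, [::]); (3, [::])];
  BadFactor 22091 22091 420966097 [::] [:: (2, [::])];
  BadExponent 22109 [:: (5527, [::]); (307, [::]); (17, [::]); (2, [::])];
  BadFactor 22111 22111 2122657 [::] [:: (2, [::])];
  BadExponent 22123 [:: (1229, [::]); (307, [::]); (17, [::]); (2, [::])];
  BadExponent 22129 [:: (2, [::])];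
  BadFactor 22133 22133 375103179140424676481 [:: 103703] [:: (2, [::])];
  BadFactor 22153 22153 1472731441 [::] [:: (2, [::])];
  BadFactor 22157 22157 236749895946329 [::] [:: (227, [::]); (113, [::]); (2, [::])];
  BadFactor 22159 22159 788112998645821 [::] [:: (592771183, [:: 1187]); (1187, [::]); (593, [::]); (2, [::])];
  BadFactor 22171 22171 228804721 [::] [:: (2, [::])];
  BadExponent 22193 [:: (2, [::])];
  BadFactor 22201 149 724995323177 [:: 47] [:: (86851, [::]); (193, [::]); (2, [::])];
  BadFactor 22229 22229 498996593 [::] [:: (2, [::])];
  BadExponent 22247 [:: (227, [::]); (113, [::]); (2, [::])];
  BadFactor 22255 4451 1068241 [::] [:: (2, [::])];
  BadExponent 22271 [:: (17, [::]); (2, [::])];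
  BadExponent 22273 [:: (2, [::])];
  BadExponent 22277 [:: (5569, [::]); (2, [::])];
  BadFactor 22279 22279 382447414462613362297 [:: 3593] [:: (3593, [::]); (449, [::]); (2, [::])];
  BadFactor 22283 22283 10673801680531537 [:: 3326465143; 523] [:: (2, [::])];
  BadFactor 22303 22303 5573455883623193 [:: 31237142333; 13395001; 47] [:: (31237142333, [:: 13395001; 47]); (13395001, [:: 47]); (5, [::])];
  BadFactor 22305 1487 1005777061 [::] [:: (11273, [::]); (1409, [::]); (2, [::])];
  BadFactor 22307 22307 10618133 [::] [:: (17, [::]); (2, [::])];
  BadFactor 22343 22343 2833092401 [::] [:: (2, [::])];
  BadFactor 22349 22349 10165429328655061 [:: 977] [:: (3, [::])];
  BadFactor 22367 22367 470959553 [::] [:: (2, [::])];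
  BadExponent 22369 [:: (2, [::])];
  BadFactor 22381 22381 1074289 [::] [:: (2, [::])];
  BadFactor 22391 22391 3803245697 [::] [:: (2, [::])];
  BadFactor 22397 22397 1163803068458200957 [:: 4330204448729; 763435199; 381717599; 190858799; 564671] [:: (4330204448729, [:: 763435199; 381717599; 190858799; 564671]); (763435199, [:: 381717599; 190858799; 564671]); (381717599, [:: 190858799; 564671]); (190858799, [:: 564671]); (564671, [::]); (56467, [::]); (3137, [::]); (2, [::])];
  BadExponent 22409 [:: (2801, [::]); (2, [::])];
  BadFactor 22415 4483 315016224294903256201 [:: 121727] [:: (23466167, [:: 11733083; 673]); (11733083, [:: 673]); (673, [::]); (2, [::])];
  BadFactor 22427 547 2870657 [::] [:: (2, [::])];
  BadExponent 22433 [:: (2, [::])];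
  BadExponent 22441 [:: (17, [::]); (2, [::])];
  BadFactor 22447 22447 3052793 [::] [:: (17, [::]); (2, [::])];
  BadExponent 22453 [:: (1871, [::]); (17, [::]); (2, [::])];
  BadFactor 22461 7487 359377 [::] [:: (2, [::])];
  BadExponent 22469 [:: (137, [::]); (17, [::]); (2, [::])];
  BadExponent 22481 [:: (2, [::])];
  BadExponent 22483 [:: (1249, [::]); (2, [::])]])%num.

Fixpoint all_step2 (f : N -> bool) (n : N) (k : nat) : bool :=
  if k is k'.+1 then f n && all_step2 f (N.add n 2) k' else true.

Lemma all_step2P f n k i : all_step2 f n k -> i < k -> f (N.add n (N.of_nat (2 * i))).
Proof.
elim: k n i => // k IHk n [|i] /= /andP[fn fk]; first by rewrite N.add_0_r.
rewrite ltnS => /(IHk _ _ fk).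
by congr (is_true (f _)); lia.
Qed.

Definition settled (n : N) : bool :=
  has (fun o => dvdb (exponent o) n) obstructions
  || has (N.eqb (N.mul 2 n)) candidates.

Lemma obstructions_valid : all valid obstructions.
Proof. by vm_compute. Qed.

(** The 1250 odd numbers [20001, 20003, ..., 22499] are the [n] for which [2 * n]
    lies in the range. *)
Lemma all_settled : all_step2 settled 20001 1250.
Proof. by vm_compute. Qed.

Theorem theorem19 (m : nat) :
  H_even m -> 40000 < m <= 45000 ->
  m \in [:: 40234; 40466; 40538; 40574; 40822; 40886; 41126; 41326; 41386;
            41714; 41758; 41878; 41898; 42134; 42314; 42358; 42646; 42766;
            43058; 43154; 43322; 43402; 43574; 43634; 43642; 43678; 43786;
            44054; 44186; 44294; 44378; 44518; 44582].
Proof.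
move=> mH; have [n n_odd Em] := H_even_double_odd mH; case: mH => mH _.
rewrite Em in mH *.
rewrite -[40000]/(N.to_nat 40000) -[45000]/(N.to_nat 45000) => /andP[n_gt n_le].
have En2 := odd_double_half n; rewrite n_odd in En2.
pose i := n./2 - N.to_nat 10000.
have En : N.add 20001 (N.of_nat (2 * i)) = N.of_nat n by rewrite /i; lia.
have i_lt : i < 1250 by rewrite /i; lia.
have /orP[os_n|/hasP[c c_in /N.eqb_spec Ec]] := all_step2P all_settled i_lt.
  by rewrite En in os_n; case: (has_validP obstructions_valid n_odd os_n).
set listed := (X in _ \in X).
(* the unary literals are compared by computing a boolean, not by unification *)
suff -> : listed = map N.to_nat candidates.
  by have -> : 2 * n = N.to_nat c by [rewrite -Ec En; lia]; exact: map_f.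
by apply/eqP; vm_compute.
Qed.
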